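(* Let $p$ be a monic complex polynomial of degree $d$ with simple roots $\lambda_1,\dots,\lambda_d$, let $q$ be a complex polynomial of degree at most $d-1$ with $q(\lambda_j)\neq0$ for all $j$, and let $r=p/q$. Let $M\subset\mathbb{C}$ be a nonempty compact set, and let $C_\Sigma(M)$ be the unital commutative Banach algebra of continuous functions $M\to\mathbb{C}^d$ with the product $\circledcirc$ determined by the multiplication table $$\sigma_{ij}=\frac{1}{r'(\lambda_j)}\,\frac{1}{\lambda_i-\lambda_j}\qquad(i\neq j).$$ Then all characters of $C_\Sigma(M)$ are of the form $$\chi_z:\ f\mapsto\sum_{i=1}^d\delta_i(z)\,f_i(r(z)),\qquad z\in r^{-1}(M).$$ In particular, identifying the character $\chi_z$ with the point $z\in r^{-1}(M)$, the Gelfand transformation $f\mapsto\hat f$ is given by $\hat f(z)=\chi_z(f)$.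
   Context: For $j=1,\dots,d$, $\delta_j(z)=\dfrac{r(z)}{r'(\lambda_j)(z-\lambda_j)}$, with the removable singularity at $\lambda_j$ removed. The set $r^{-1}(M)$ is $\{z\in\mathbb{C}:q(z)\ne0,\ r(z)\in M\}$. The product: let $e_1,\dots,e_d$ be the standard basis of $\mathbb{C}^d$. For fixed $w\in M$ define on $\mathbb{C}^d$, extending bilinearly, $$e_i\circledcirc e_i=e_i-w\sum_{j\ne i}(\sigma_{ij}e_i+\sigma_{ji}e_j),\qquad e_i\circledcirc e_j=w(\sigma_{ij}e_i+\sigma_{ji}e_j)\quad(j\ne i).$$ For functions $f=\sum_i f_ie_i,\ g=\sum_i g_ie_i\in C(M)^d$ the product $f\circledcirc g$ is defined pointwise: $(f\circledcirc g)(w)$ is the product of $f(w)$ and $g(w)$ in $\mathbb{C}^d$ with parameter $w$. The unit is the constant function $\mathbf{1}=\sum_i e_i$. The norm is $\|f\|=\sup_{|g|_\infty\le1}|f\circledcirc g|_\infty$, where $|f|_\infty=\max_{j}\max_{w\in M}|f_j(w)|$; it is equivalent to $|\cdot|_\infty$. With this product and norm $C(M)^d$ is the unital commutative Banach algebra denoted $C_\Sigma(M)$. A character is a nontrivial continuous multiplicative linear functional $C_\Sigma(M)\to\mathbb{C}$. *)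

(* Defs.v *)
From HB Require Import structures.
From mathcomp Require Import all_boot all_order all_algebra.
From mathcomp Require Import complex.
From mathcomp Require Import all_classical all_reals all_analysis.

Set Implicit Arguments.
Unset Strict Implicit.
Unset Printing Implicit Defensive.

Import numFieldNormedType.Exports.
Import Order.TTheory GRing.Theory Num.Theory.
Local Open Scope classical_set_scope.
Local Open Scope ring_scope.

(* R[i], packed as a numClosedFieldType so that it receives the norm topology
   which the library attaches to every such structure. *)
Definition C (R : realType) : numClosedFieldType := R[i]%C.

(* The library's norm `|z| of a complex number is again an element of R[i]. *)
Definition cabs (R : realType) (z : C R) : R := ComplexField.Normc.normc z.

Section Algebra.
Variables (R : realType) (d : nat).

Definition basis_vec (i : 'I_d) : 'rV[C R]_d := delta_mx 0 i.

Section Product.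
Variable sigma : 'I_d -> 'I_d -> C R.

Definition basis_mul (w : C R) (i j : 'I_d) : 'rV[C R]_d :=
  if i == j then
    basis_vec i
    - w *: \sum_(k | k != i)
             (sigma i k *: basis_vec i + sigma k i *: basis_vec k)
  else w *: (sigma i j *: basis_vec i + sigma j i *: basis_vec j).

Definition vec_mul (w : C R) (x y : 'rV[C R]_d) : 'rV[C R]_d :=
  \sum_i \sum_j (x 0 i * y 0 j) *: basis_mul w i j.

End Product.

(* Stated over an abstract T, since unification unfolds the topology of a
   set_type. *)
Lemma linear_combination_cts (T : topologicalType) (a : C R)
    (f g : T -> 'rV[C R]_d) :
  continuous f -> continuous g -> continuous (fun w => a *: f w + g w).
Proof.
move=> cf cg w; apply: (@cvgD _ 'rV[C R]_d); last exact: cg.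
by apply: cvgZl_tmp; exact: cf.
Qed.

Lemma vec_mul_comp_cts (sigma : 'I_d -> 'I_d -> C R) (T : topologicalType)
    (u : T -> C R) (f g : T -> 'rV[C R]_d) :
  continuous u -> continuous f -> continuous g ->
  continuous (fun w => vec_mul sigma (u w) (f w) (g w)).
Proof.
move=> cu cf cg w; rewrite /continuous_at /vec_mul.
apply: (@cvg_big _ _ +%R 0 xpredT (@add_continuous _)) => i _.
apply: (@cvg_big _ _ +%R 0 xpredT (@add_continuous _)) => j _.
apply: (@cvgZ (C R) 'rV[C R]_d T _ _ (fun w => f w 0 i * g w 0 j)
  (fun w => basis_mul sigma (u w) i j)).
  apply: (@cvgM (C R) T _ _ (fun w => f w 0 i) (fun w => g w 0 j)).
    exact: (cvg_comp _ _ (cf w) (@coord_continuous _ _ _ 0 i (f w))).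
  exact: (cvg_comp _ _ (cg w) (@coord_continuous _ _ _ 0 j (g w))).
rewrite /basis_mul; case: ifP => _.
  apply: (@cvgB _ 'rV[C R]_d); first exact: cvg_cst.
  by apply: cvgZr_tmp; exact: cu.
by apply: cvgZr_tmp; exact: cu.
Qed.

Variable M : set (C R).

Definition cts_pred : {pred (M -> 'rV[C R]_d)} :=
  fun f => `[< continuous f >].

Lemma cts_submod : submod_closed cts_pred.
Proof.
split=> [|a f g /asboolP cf /asboolP cg]; apply/asboolP.
  exact: (@cst_continuous _ _ (0 : 'rV[C R]_d)).
exact: (@linear_combination_cts M a f g cf cg).
Qed.

HB.instance Definition _ :=
  GRing.isSubmodClosed.Build (C R) (M -> 'rV[C R]_d) cts_pred cts_submod.

Record cvfun := CVFun {
  cvfun_val :> M -> 'rV[C R]_d ;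
  cvfun_cts : cvfun_val \in cts_pred }.

HB.instance Definition _ := [isSub for cvfun_val].
HB.instance Definition _ := [Choice of cvfun by <:].
HB.instance Definition _ := [SubChoice_isSubLmodule of cvfun by <:].

Lemma vec_mul_cts (sigma : 'I_d -> 'I_d -> C R) (f g : cvfun) :
  (fun w : M => vec_mul sigma (\val w) (f w) (g w)) \in cts_pred.
Proof.
have /asboolP cf := cvfun_cts f; have /asboolP cg := cvfun_cts g.
have cM : continuous (fun w : M => \val w : C R) by exact: initial_continuous.
apply/asboolP; exact: (@vec_mul_comp_cts sigma M _ f g cM cf cg).
Qed.

Definition cs_mul (sigma : 'I_d -> 'I_d -> C R) (f g : cvfun) : cvfun :=
  CVFun (vec_mul_cts sigma f g).

Definition sup_norm (f : cvfun) : R :=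
  \big[Num.max/0]_(j < d) sup [set cabs (f w 0 j) | w in [set: M]].

Definition cs_norm (sigma : 'I_d -> 'I_d -> C R) (f : cvfun) : R :=
  sup [set sup_norm (cs_mul sigma f g) | g in [set g | sup_norm g <= 1]].

Definition cs_continuous (sigma : 'I_d -> 'I_d -> C R) (phi : cvfun -> C R) :=
  forall (f : cvfun) (e : R), 0 < e -> exists2 eta : R, 0 < eta &
    forall g : cvfun, cs_norm sigma (g - f) < eta -> cabs (phi g - phi f) < e.

Record is_character (sigma : 'I_d -> 'I_d -> C R) (phi : cvfun -> C R) : Prop :=
  IsCharacter {
    character_nontrivial : exists f, phi f != 0 ;
    character_continuous : cs_continuous sigma phi ;
    character_mul : forall f g, phi (cs_mul sigma f g) = phi f * phi g ;
    character_linear : scalar phi }.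

Record character (sigma : 'I_d -> 'I_d -> C R) := Character {
  char_fun :> cvfun -> C R ;
  charP : is_character sigma char_fun }.

Definition gelfand (sigma : 'I_d -> 'I_d -> C R) (f : cvfun) :
  character sigma -> C R := fun phi => phi f.

End Algebra.

Section Rational.
Variables (R : realType) (p q : {poly C R}).

Definition ratfun (z : C R) : C R := p.[z] / q.[z].

Definition rat_preimage (M : set (C R)) : set (C R) :=
  [set z | q.[z] != 0 /\ M (ratfun z)].

Definition ratfun_on (M : set (C R)) (z : rat_preimage M) : M :=
  SigSub (mem_set (proj2 (set_valP z))).

Variables (d : nat) (lam : 'I_d -> C R).

(* Only the entries with i != j are used by the product. *)
Definition rat_table (i j : 'I_d) : C R :=
  (derive1 ratfun (lam j))^-1 * (lam i - lam j)^-1.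

Definition delta_quot (j : 'I_d) (z : C R) : C R :=
  ratfun z / (derive1 ratfun (lam j) * (z - lam j)).

Definition delta (j : 'I_d) (z : C R) : C R :=
  if z == lam j then lim (delta_quot j u @[u --> (lam j)^'])
  else delta_quot j z.

Definition chi (M : set (C R)) (z : rat_preimage M) (f : cvfun d M) : C R :=
  \sum_(i < d) delta i (\val z) * f (ratfun_on z) 0 i.

End Rational.

(* Main.v *)
Require Import Defs.
From HB Require Import structures.
From mathcomp Require Import all_boot all_order all_algebra.
From mathcomp Require Import complex.
From mathcomp Require Import all_classical all_reals all_analysis.
From mathcomp Require Import ring.

Set Implicit Arguments.
Unset Strict Implicit.
Unset Printing Implicit Defensive.

Import numFieldNormedType.Exports.
Import Order.TTheory GRing.Theory Num.Theory.
Local Open Scope classical_set_scope.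
Local Open Scope ring_scope.

(** Write [a_i] for [r'(lam_i)], [s_i] for the product of the [X - lam_k] with
    [k <> i], and [c(x)] for the sum of the [c_i x_i].

    A character [phi] of the algebra restricts to a unital homomorphism on the
    functions [h.1] with [h] in [C(M)], hence it is evaluation at some point
    [w] of [M] there: if [u] is the inclusion of [M] in the plane and [h] is continuous, then
    [|u - phi(u)|^2 + |h - phi(h)|^2] is killed by [phi], so it is not
    invertible and vanishes at a point, where [u = phi(u)] and [h = phi(h)]
    ([multiplicative_eval]). Since [f] is the sum of the
    [(f_i.1) e_i], this gives [phi(f) = c(f(w))] with [c_i = phi(e_i)], and the
    multiplication table turns into the equations of [structure_point]: the
    [c_i] sum to [1], and [c_i c_j = w (sigma_ij c_i + sigma_ji c_j)] for
    [i <> j] ([character_structure_point]).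

    These equations are then solved for the table of [r]. The values
    [c_i = delta_i(z)] solve them with [w = r(z)] because
    [(z - lam_i) delta_i(z) = r(z) / a_i] and because Lagrange interpolation of
    [q] at the [lam_i] gives [sum_i delta_i(z) = 1] ([delta_point]).
    Conversely, put [z = sum_i lam_i c_i + w sum_i 1/a_i] ([node_center]).
    The equations imply [(z - lam_i) c_i = w / a_i] for all [i] at once,
    whether or not [w = 0]. Multiplying by [s_i(z)] and summing gives
    [p(z) = w q(z)] by interpolation; as [p] and [q] have no common zero,
    [q(z) <> 0] and [r(z) = w], and then [c_i = delta_i(z)]
    ([structure_pointE]). The same formula recovers [z] from the functional
    [chi_z], so distinct points give distinct characters.

    Finally every solution [c] at a point of [M] defines a character. Being
    multiplicative is a computation on the basis
    ([coord_form_mul]); for continuity, the unit lies in the unit ball, so the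
    operator norm dominates the sup norm once the supremum defining it is
    finite, and this is where compactness of [M] enters
    ([sup_norm_le_cs_norm]). *)

(** * Lagrange interpolation at the roots of the numerator *)

Section Lagrange.
Variables (F : fieldType) (d : nat) (lam : 'I_d -> F).
Hypothesis lam_inj : injective lam.

Definition node_poly (i : 'I_d) : {poly F} :=
  \prod_(k | k != i) ('X - (lam k)%:P).

Lemma node_poly_self i : (node_poly i).[lam i] != 0.
Proof.
rewrite horner_prod; apply/prodf_neq0 => k ki.
by rewrite hornerXsubC subr_eq0; apply: contra_neq ki => /lam_inj.
Qed.

Lemma node_poly_other i j : i != j -> (node_poly i).[lam j] = 0.
Proof.
by move=> ij; rewrite horner_prod (bigD1 j) 1?eq_sym//= hornerXsubC subrr mul0r.
Qed.

Lemma size_node_poly i : size (node_poly i) = d.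
Proof.
rewrite /node_poly -big_enum size_prod_XsubC -cardE cardC1 card_ord prednK//.
exact: leq_ltn_trans (ltn_ord i).
Qed.

Lemma monic_nodesE (p : {poly F}) : p \is monic -> size p = d.+1 ->
  (forall j, root p (lam j)) -> p = \prod_i ('X - (lam i)%:P).
Proof.
move=> pm ps pr.
have := @all_roots_prod_XsubC _ p [seq lam j | j <- enum 'I_d].
rewrite size_map size_enum_ord ps => /(_ erefl).
have -> : all (root p) [seq lam j | j <- enum 'I_d].
  by apply/allP => _ /mapP[j _ ->].
rewrite uniq_rootsE map_inj_uniq// enum_uniq (monicP pm) scale1r.
by move=> /(_ isT isT) ->; rewrite big_map big_enum.
Qed.

Lemma node_polyE (p : {poly F}) (i : 'I_d) : p \is monic -> size p = d.+1 ->
  (forall j, root p (lam j)) -> p = ('X - (lam i)%:P) * node_poly i.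
Proof. by move=> pm ps pr; rewrite {1}(monic_nodesE pm ps pr) (bigD1 i). Qed.

(** The difference of both sides has size at most [d] and vanishes at [d]
    distinct nodes. *)
Lemma lagrange_interpolation (q : {poly F}) : (size q <= d)%N ->
  \sum_i (q.[lam i] / (node_poly i).[lam i]) *: node_poly i = q.
Proof.
move=> qd; apply/eqP; rewrite -subr_eq0; apply/eqP.
apply: (@roots_geq_poly_eq0 _ _ [seq lam j | j <- enum 'I_d]).
- apply/allP => _ /mapP[j _ ->]; rewrite rootE hornerD hornerN horner_sum.
  rewrite (bigD1 j)//= big1 => [|k kj]; last first.
    by rewrite hornerZ (node_poly_other kj) mulr0.
  by rewrite addr0 hornerZ divfK ?subrr// node_poly_self.
- by rewrite map_inj_uniq// enum_uniq.
- rewrite size_map size_enum_ord (leq_trans (size_polyD _ _))// size_polyN.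
  rewrite geq_max qd andbT (leq_trans (size_sum _ _ _))//.
  apply/bigmax_leqP => k _.
  by rewrite (leq_trans (size_scale_leq _ _))// size_node_poly.
Qed.

End Lagrange.

Lemma mulf_cancel_ratio (F : fieldType) (t s q a : F) :
  t != 0 -> t * s / q / (a * t) = s / q / a.
Proof.
move=> t0; rewrite invfM [t * s]mulrC -!mulrA; congr (_ * _).
by rewrite 2!(mulrCA t) divff// mulr1.
Qed.

Lemma horner_continuous (K : numFieldType) (p : {poly K}) :
  continuous (fun z => p.[z]).
Proof.
elim/poly_ind: p => [|p c ih] z.
  under eq_fun do rewrite horner0.
  exact: cst_continuous.
under eq_fun do rewrite hornerMXaddC.
apply: (@continuousD _ _ _ (fun z => p.[z] * z) (cst c)).
  by apply: (@continuousM _ _ (fun z => p.[z]) id); [exact: ih|exact: cvg_id].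
exact: cst_continuous.
Qed.

(** * Limits of a rational function at a simple zero *)

Section RationalLimits.
Variables (R : realType) (p q s : {poly C R}) (l : C R).
Hypotheses (ps : p = ('X - l%:P) * s) (ql : q.[l] != 0).

Lemma quot_cvg : (fun z => s.[z] / q.[z]) @ l^' --> s.[l] / q.[l].
Proof.
apply: cvgM.
  apply: cvg_within_filter; exact: horner_continuous.
apply: cvgV => //.
apply: cvg_within_filter; exact: horner_continuous.
Qed.

(** Removing the singularity of [r(z) / (a (z - l))]: with [a = 1] this is the
    difference quotient of [r] at [l], and with [a = r'(l)] it is [delta]. *)
Lemma ratfun_quot_cvg a : a != 0 ->
  (fun z => ratfun p q z / (a * (z - l))) @ l^' --> s.[l] / q.[l] / a.
Proof.
move=> a0; apply: cvg_trans (cvgM quot_cvg (cvg_cst a^-1)).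
apply: near_eq_cvg; rewrite near_withinE; near=> z => zl.
rewrite /ratfun ps hornerM hornerXsubC /=.
have zl0 : z - l != 0 by rewrite subr_eq0.
by rewrite mulf_cancel_ratio.
Unshelve. all: by end_near. Qed.

Lemma derive1_ratfun : derive1 (ratfun p q) l = s.[l] / q.[l].
Proof.
rewrite /derive1; apply: (@cvg_lim (C R : numFieldType)^o) => //.
have r0 : ratfun p q l = 0.
  by rewrite /ratfun ps hornerM hornerXsubC subrr mul0r mul0r.
have shift : h + l @[h --> 0^'] --> l^'.
  move=> A lA; have := (nbhs0P (fun y => y != l -> A y) l).1 lA.
  apply: filterS => h Ah h0.
  by rewrite /= addrC; apply: Ah; rewrite addrC -subr_eq0 addrK.
have := cvg_comp _ _ shift (ratfun_quot_cvg (oner_neq0 (C R))).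
rewrite divr1; apply: cvg_trans; apply: near_eq_cvg; apply: nearW => h /=.
by rewrite r0 subr0 addrK mul1r mulrC.
Qed.

End RationalLimits.

(** * The values of a character on the standard basis *)

(** Exactly the conditions under which [x |-> \sum_i c i * x 0 i] is a unital
    algebra homomorphism for the product with parameter [w]. The
    equations for [c i ^+ 2] are consequences, as [e_i] times the unit is
    [e_i]. *)
Definition structure_point (R : realType) (d : nat)
    (sigma : 'I_d -> 'I_d -> C R) (w : C R) (c : 'I_d -> C R) : Prop :=
  \sum_i c i = 1 /\ forall i j, i != j ->
    c i * c j = w * (sigma i j * c i + sigma j i * c j).

Section Nodes.
Variables (R : realType) (d : nat) (p q : {poly C R}) (lam : 'I_d -> C R).
Hypotheses (p_monic : p \is monic) (p_deg : size p = d.+1).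
Hypotheses (lam_inj : injective lam) (lam_root : forall j, root p (lam j)).
Hypotheses (q_deg : (size q <= d)%N) (q_lam : forall j, q.[lam j] != 0).

Let pE i := node_polyE lam_inj i p_monic p_deg lam_root.

(** This is [r'(lam_i)]; see [derive1_ratfunE]. *)
Definition node_weight (i : 'I_d) : C R :=
  (node_poly lam i).[lam i] / q.[lam i].

Lemma node_weight_neq0 i : node_weight i != 0.
Proof. by rewrite mulf_neq0 ?invr_neq0 ?node_poly_self. Qed.

Lemma derive1_ratfunE i : derive1 (ratfun p q) (lam i) = node_weight i.
Proof. exact: derive1_ratfun (pE i) (q_lam i). Qed.

(** This single formula holds at the nodes too, so that no later argument has
    to treat [z = lam i] apart. *)
Lemma deltaE i z : q.[z] != 0 ->
  delta p q lam i z = (node_poly lam i).[z] / q.[z] / node_weight i.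
Proof.
move=> qz; rewrite /delta; case: eqP => [->|/eqP zl].
  apply: (@cvg_lim (C R : numFieldType)^o) => //.
  rewrite /delta_quot derive1_ratfunE.
  exact: ratfun_quot_cvg (pE i) (q_lam i) _ (node_weight_neq0 i).
have zl0 : z - lam i != 0 by rewrite subr_eq0.
rewrite /delta_quot derive1_ratfunE /ratfun {1}(pE i) hornerM hornerXsubC.
exact: mulf_cancel_ratio.
Qed.

Lemma rat_tableE i j :
  rat_table p q lam i j = (node_weight j)^-1 / (lam i - lam j).
Proof. by rewrite /rat_table derive1_ratfunE. Qed.

(** Lagrange interpolation of [q], evaluated at [z]. *)
Lemma sum_node_quot (z : C R) :
  \sum_i (node_poly lam i).[z] / node_weight i = q.[z].
Proof.
rewrite -[in RHS](lagrange_interpolation lam_inj q_deg) horner_sum.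
by apply: eq_bigr => i _; rewrite hornerZ /node_weight invf_div mulrC.
Qed.

Lemma sum_delta z : q.[z] != 0 -> \sum_i delta p q lam i z = 1.
Proof.
move=> qz; under eq_bigr do rewrite deltaE// mulrAC.
by rewrite -mulr_suml sum_node_quot divff.
Qed.

Lemma delta_sub_node z i : q.[z] != 0 ->
  (z - lam i) * delta p q lam i z = ratfun p q z / node_weight i.
Proof.
by move=> qz; rewrite deltaE// /ratfun (pE i) hornerM hornerXsubC !mulrA.
Qed.

(** With [(z - lam i) * delta i z = r z / a_i], the identity comes from
    [lam i - lam j = (z - lam j) - (z - lam i)]. *)
Lemma delta_point z : q.[z] != 0 ->
  structure_point (rat_table p q lam) (ratfun p q z)
    (fun i => delta p q lam i z).
Proof.
move=> qz; split; first exact: sum_delta.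
move=> i j ij; rewrite !rat_tableE mulrDr.
have lij : lam i - lam j != 0.
  by rewrite subr_eq0; apply: contra_neq ij => /lam_inj.
have -> : (lam j - lam i)^-1 = - (lam i - lam j)^-1.
  by rewrite -invrN opprB.
apply: (mulIf lij).
have := delta_sub_node i qz; have := delta_sub_node j qz.
set x := delta _ _ _ i z; set y := delta _ _ _ j z; set w := ratfun _ _ _.
set a := node_weight i; set b := node_weight j => ey ex.
have -> : x * y * (lam i - lam j) =
    x * ((z - lam j) * y) - y * ((z - lam i) * x).
  by ring.
rewrite ex ey.
have a0 : a != 0 := node_weight_neq0 i; have b0 : b != 0 := node_weight_neq0 j.
by field; rewrite lij a0.
Qed.

(** A formula for [z] in terms of [w = r z] and [c = delta z], obtained by
    summing [z * c i = lam i * c i + w / node_weight i] over [i]. *)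
Definition node_center w (c : 'I_d -> C R) : C R :=
  \sum_i lam i * c i + w * \sum_i (node_weight i)^-1.

Lemma node_center_delta z : q.[z] != 0 ->
  node_center (ratfun p q z) (fun i => delta p q lam i z) = z.
Proof.
move=> qz; rewrite /node_center mulr_sumr -big_split/=.
under eq_bigr do rewrite -delta_sub_node// -mulrDl addrC subrK.
by rewrite -mulr_sumr sum_delta// mulr1.
Qed.

(** Expand [node_center w c - lam i] against [\sum_j c j = 1]: multiplied by
    [c i], the terms [(lam j - lam i) * (c i * c j)] are known from the structure
    equations, and everything except [w / node_weight i * c j] cancels. *)
Lemma node_center_sub w c i : structure_point (rat_table p q lam) w c ->
  (node_center w c - lam i) * c i = w / node_weight i.
Proof.
move=> [c1 cm].
have -> : node_center w c - lam i =
    \sum_j ((lam j - lam i) * c j + w / node_weight j).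
  rewrite big_split/= -mulr_sumr /node_center addrAC; congr (_ + _).
  under [RHS]eq_bigr do rewrite mulrBl.
  by rewrite sumrB -mulr_sumr c1 mulr1.
rewrite mulr_suml.
transitivity (\sum_j w / node_weight i * c j); last first.
  by rewrite -mulr_sumr c1 mulr1.
apply: eq_bigr => j _; have [->|ij] := eqVneq j i.
  by rewrite subrr mul0r add0r.
rewrite mulrDl -mulrA cm// !rat_tableE.
have lij : lam i - lam j != 0.
  by rewrite subr_eq0; apply: contra_neq ij => /lam_inj.
have lji : lam j - lam i != 0 by rewrite -opprB oppr_eq0.
have := node_weight_neq0 i; have := node_weight_neq0 j.
by move=> *; field; apply/and4P; split.
Qed.

(** The point is [z = node_center w c]. From [(z - lam i) * c i = w / a_i] and
    interpolation, [p.[z] = w * q.[z]]; a zero of [q] at [z] would be a zero of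
    [p], that is a node, where [q] does not vanish. *)
Lemma structure_pointE w c : structure_point (rat_table p q lam) w c ->
  exists z, [/\ q.[z] != 0, ratfun p q z = w &
                forall i, c i = delta p q lam i z].
Proof.
move=> cw; set z := node_center w c; exists z; have [c1 _] := cw.
have zc i : (z - lam i) * c i = w / node_weight i := node_center_sub i cw.
have pz : p.[z] = w * q.[z].
  rewrite -[LHS]mulr1 -c1 mulr_sumr -sum_node_quot mulr_sumr.
  apply: eq_bigr => i _.
  rewrite (pE i) hornerM hornerXsubC mulrAC zc.
  by rewrite mulrC mulrCA.
have qz : q.[z] != 0.
  apply/negP => /eqP qz0.
  move: pz; rewrite qz0 mulr0.
  rewrite (monic_nodesE lam_inj p_monic p_deg lam_root) horner_prod.
  move=> /eqP; rewrite prodf_seq_eq0 => /hasP[i _].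
  rewrite hornerXsubC subr_eq0 => /eqP zl.
  by move: (q_lam i); rewrite -zl qz0 eqxx.
have rz : ratfun p q z = w by rewrite /ratfun pz mulfK.
have off i : z != lam i -> c i = delta p q lam i z.
  rewrite -subr_eq0 => zl; apply: (mulfI zl).
  by rewrite zc delta_sub_node// rz.
(* If z is the node lam i, then c i is not determined by its own equation;
   it is the complement to 1 of the other values. *)
split=> // i; have [zl|] := eqVneq z (lam i); last exact: off.
have := c1; rewrite -(sum_delta qz) (bigD1 i)//= [RHS](bigD1 i)//=.
rewrite (eq_bigr (fun k => delta p q lam k z)); first exact: addIr.
by move=> k ki; apply: off; rewrite zl; apply: contra_neq ki => /lam_inj.
Qed.

End Nodes.

(** * The product on vectors and multiplicative linear forms *)

Section VecMul.
Variables (R : realType) (d : nat) (sigma : 'I_d -> 'I_d -> C R).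
Implicit Types (w : C R) (c : 'I_d -> C R) (x y : 'rV[C R]_d).

(** The all-ones vector is the unit: the off-diagonal products
    [e_i * e_k] add up to what is subtracted in [e_i * e_i]. *)
Lemma vec_mul_unit w x (a : C R) : vec_mul sigma w x (const_mx a) = a *: x.
Proof.
rewrite /vec_mul [in RHS](row_sum_delta x) scaler_sumr; apply: eq_bigr => i _.
under eq_bigr do rewrite mxE.
rewrite -scaler_sumr mulrC -scalerA; congr (_ *: (_ *: _)).
rewrite (bigD1 i)//= {1}/basis_mul eqxx scaler_sumr.
rewrite [X in _ + X](eq_bigr
  (fun k => w *: (sigma i k *: basis_vec R i + sigma k i *: basis_vec R k))).
  by rewrite subrK.
by move=> k ki; rewrite /basis_mul eq_sym (negPf ki).
Qed.

Lemma vec_mul_basis w i j :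
  vec_mul sigma w (basis_vec R i) (basis_vec R j) = basis_mul sigma w i j.
Proof.
rewrite /vec_mul (bigD1 i)//= [X in _ + X]big1 => [|k ki]; last first.
  rewrite big1// => l _.
  by rewrite [basis_vec _ _ _ _]mxE (negPf ki) andbF mul0r scale0r.
rewrite addr0 (bigD1 j)//= [X in _ + X]big1 => [|k kj]; last first.
  by rewrite [basis_vec _ j _ _]mxE (negPf kj) andbF mulr0 scale0r.
by rewrite addr0 !mxE !eqxx mulr1 scale1r.
Qed.

Definition coord_form c x : C R := \sum_i c i * x 0 i.

Lemma coord_form_is_scalar c : scalar (coord_form c).
Proof.
move=> a x y; rewrite /coord_form mulr_sumr -big_split/=.
by apply: eq_bigr => i _; rewrite !mxE mulrDr mulrCA.
Qed.

HB.instance Definition _ c :=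
  GRing.isLinear.Build (C R) 'rV[C R]_d (C R) *%R (coord_form c)
    (coord_form_is_scalar c).

Lemma coord_form_basis c i : coord_form c (basis_vec R i) = c i.
Proof.
rewrite /coord_form (bigD1 i)//= big1 => [|k ki]; last first.
  by rewrite mxE (negPf ki) andbF mulr0.
by rewrite mxE !eqxx mulr1 addr0.
Qed.

(** On the diagonal, [c i ^+ 2 = c i * (1 - \sum_(k != i) c k)] reduces the claim
    to the off-diagonal equations. *)
Lemma coord_form_basis_mul w c i j : structure_point sigma w c ->
  coord_form c (basis_mul sigma w i j) = c i * c j.
Proof.
move=> [c1 cm]; rewrite /basis_mul; case: eqVneq => [<-|ij].
  rewrite linearB linearZ/= linear_sum/=.
  under eq_bigr do rewrite linearD !linearZ/= !coord_form_basis.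
  rewrite coord_form_basis mulr_sumr.
  under eq_bigr => k ki do rewrite -cm 1?eq_sym//.
  rewrite -mulr_sumr -{1}[c i]mulr1 -mulrBr; congr (_ * _).
  by rewrite -c1 (bigD1 i)//= addrK.
by rewrite linearZ/= linearD !linearZ/= !coord_form_basis cm.
Qed.

Lemma coord_form_mul w c x y : structure_point sigma w c ->
  coord_form c (vec_mul sigma w x y) = coord_form c x * coord_form c y.
Proof.
move=> cw; rewrite /vec_mul linear_sum/= [in RHS]/coord_form mulr_suml.
apply: eq_bigr => i _; rewrite linear_sum/= mulr_sumr.
apply: eq_bigr => j _; rewrite linearZ/= coord_form_basis_mul//.
by rewrite [RHS]mulrACA mulrC.
Qed.

End VecMul.

(** * Unital multiplicative functionals on continuous scalar functions *)

Lemma conjC_continuous (K : numClosedFieldType) :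
  continuous (fun z : K => z^*).
Proof.
move=> z; apply/(@cvgrPdist_le K K^o K _ (nbhs_filter (z : K))) => e e0.
have /(@cvgrPdist_le K K^o K _ (nbhs_filter (z : K)))/(_ e e0) : id y @[y --> z] --> z by exact: cvg_id.
by apply: filterS => y; rewrite -rmorphB norm_conjC.
Qed.

(** Over an abstract domain, as unification on a subtype unfolds its topology. *)
Lemma continuous_addf (K : numFieldType) (T : topologicalType) (h k : T -> K) :
  continuous h -> continuous k -> continuous (fun t => h t + k t).
Proof. by move=> hc kc t; apply: (@cvgD _ K^o); [exact: hc|exact: kc]. Qed.

Lemma continuous_mulf (K : numFieldType) (T : topologicalType) (h k : T -> K) :
  continuous h -> continuous k -> continuous (fun t => h t * k t).
Proof. by move=> hc kc t; apply: cvgM; [exact: hc|exact: kc]. Qed.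

Section ContinuousFunctions.
Variables (K : numClosedFieldType) (T : topologicalType).
Variables (u : T -> K) (psi : (T -> K) -> K).
Hypothesis u_cts : continuous u.
Hypothesis psiD : forall h k : T -> K, continuous h -> continuous k ->
  psi (fun t => h t + k t) = psi h + psi k.
Hypothesis psiM : forall h k : T -> K, continuous h -> continuous k ->
  psi (fun t => h t * k t) = psi h * psi k.
Hypothesis psiC : forall a, psi (fun=> a) = a.

Lemma multiplicative_unit (h : T -> K) : continuous h -> (forall t, h t != 0) ->
  psi h != 0.
Proof.
move=> hc h0; apply/eqP => ph; have := oner_neq0 K.
have hVc : continuous (fun t => (h t)^-1).
  by move=> t; apply: cvgV; [exact: h0|exact: hc].
rewrite -(psiC 1) (_ : (fun=> 1) = fun t => h t * (h t)^-1).
  by rewrite psiM// ph mul0r eqxx.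
by apply/funext => t; rewrite divff.
Qed.

(** If there were no such [t], then
    [|u - psi u|^2 + |h - psi h|^2] would have no zero, hence be invertible,
    although [psi] kills it. When [u] is injective, [t] does not depend on [h],
    so [psi] is evaluation at [t]. *)
Lemma multiplicative_eval (h : T -> K) : continuous h ->
  exists t, u t = psi u /\ h t = psi h.
Proof.
move=> hc; apply: contrapT => nt.
have cc (a : K) : continuous (fun _ : T => a) by exact: cst_continuous.
have subc (k : T -> K) : continuous k -> continuous (fun t => k t + - psi k).
  by move=> kc; apply: (continuous_addf kc); exact: cc.
have conjc (k : T -> K) : continuous k -> continuous (fun t => (k t)^*).
  move=> kc t; apply: (@cvg_comp _ _ _ k (fun z => z^*)); first exact: kc.
  exact: conjC_continuous.
have sqc (k : T -> K) : continuous k ->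
    continuous (fun t => (k t + - psi k) * (k t + - psi k)^*).
  by move=> kc; apply: continuous_mulf; [exact: subc|exact/conjc/subc].
have sq0 (k : T -> K) : continuous k ->
    psi (fun t => (k t + - psi k) * (k t + - psi k)^*) = 0.
  move=> kc; rewrite psiM; [|exact: subc|exact/conjc/subc].
  by rewrite psiD// psiC subrr mul0r.
pose g t := (u t + - psi u) * (u t + - psi u)^* +
            (h t + - psi h) * (h t + - psi h)^*.
have gc : continuous g.
  by apply: continuous_addf; exact: sqc.
have /eqP : psi g = 0 by rewrite /g psiD ?sq0 ?addr0//; exact: sqc.
apply/negP/multiplicative_unit => // t; apply/eqP => /eqP.
rewrite /g paddr_eq0 ?mul_conjC_ge0// !mul_conjC_eq0 !subr_eq0.
by move=> /andP[/eqP ut /eqP ht]; apply: nt; exists t.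
Qed.

End ContinuousFunctions.

(** * The modulus of complex numbers *)

Lemma cabsE (R : realType) (z : C R) : `|z| = (cabs z)%:C%C.
Proof. by rewrite [LHS]normc_def; case: z. Qed.

Lemma cabs_ge0 (R : realType) (z : C R) : 0 <= cabs z.
Proof. by rewrite -lecR -cabsE normr_ge0. Qed.

Lemma cabsD (R : realType) (x y : C R) : cabs (x + y) <= cabs x + cabs y.
Proof. exact: le_normcD. Qed.

Lemma cabsN (R : realType) (x : C R) : cabs (- x) = cabs x.
Proof. exact: normcN. Qed.

Lemma cabsM (R : realType) (x y : C R) : cabs (x * y) = cabs x * cabs y.
Proof. exact: ComplexField.Normc.normcM. Qed.

Lemma cabs0 (R : realType) : cabs (0 : C R) = 0.
Proof. exact: ComplexField.Normc.normc0. Qed.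

Lemma cabs1 (R : realType) : cabs (1 : C R) = 1.
Proof. exact: ComplexField.Normc.normc1. Qed.

(** * Vector-valued continuous functions *)

(** [h.1] with [1] the unit. It is total in [h], with junk value [0] when [h] is
    discontinuous, so that a functional on [cvfun d M] yields one on all scalar
    functions. Locked, because comparing two instances by conversion unfolds the
    arithmetic of [C R]. *)
HB.lock Definition scalar_fun (R : realType) (d : nat) (M : set (C R))
  (h : M -> C R) : cvfun d M := insubd 0 (fun w => const_mx (h w)).

HB.lock Definition const_fun (R : realType) (d : nat) (M : set (C R))
  (x : 'rV[C R]_d) : cvfun d M := insubd 0 (fun=> x).

Section CvFun.
Variables (R : realType) (d : nat) (M : set (C R)).

Lemma const_funE (x : 'rV[C R]_d) w : const_fun M x w = x.
Proof.
rewrite unlock -[cvfun_val _]/(\val _) val_insubd (_ : _ \in _)//.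
by apply/asboolP; exact: cst_continuous.
Qed.

Lemma const_mx_continuous (T : topologicalType) (h : T -> C R) :
  continuous h -> continuous (fun t => const_mx (h t) : 'rV[C R]_d).
Proof.
move=> hc t; have cE (a : C R) : const_mx a = a *: const_mx 1 :> 'rV[C R]_d.
  by apply/rowP => i; rewrite !mxE mulr1.
rewrite /continuous_at cE; under eq_fun do rewrite cE.
by apply: (@cvgZr_tmp _ 'rV[C R]_d); exact: hc.
Qed.

Lemma scalar_funE (h : M -> C R) w : continuous h -> scalar_fun d h w = const_mx (h w).
Proof.
move=> hc; rewrite unlock -[cvfun_val _]/(\val _) val_insubd.
rewrite (_ : _ \in _)//; apply/asboolP; exact: (@const_mx_continuous M h hc).
Qed.

Lemma coord_continuous_cv (f : cvfun d M) i : continuous (fun w => f w 0 i).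
Proof.
have /asboolP cf := cvfun_cts f.
move=> w; exact: (cvg_comp _ _ (cf w) (@coord_continuous _ _ _ 0 i (f w))).
Qed.

Lemma cvfun_eq (f g : cvfun d M) : f =1 g -> f = g.
Proof. by move=> fg; apply/val_inj/funext. Qed.

Lemma cvfunD (f g : cvfun d M) w : (f + g) w = f w + g w.
Proof. by rewrite -[cvfun_val _]/(\val _) raddfD. Qed.

Lemma cvfunZ a (f : cvfun d M) w : (a *: f) w = a *: f w.
Proof. by rewrite -[cvfun_val _]/(\val _) linearZ. Qed.

Lemma cvfunB (f g : cvfun d M) w : (f - g) w = f w - g w.
Proof. by rewrite -[cvfun_val _]/(\val _) raddfB. Qed.

Lemma cvfun_sum I (r : seq I) P (F : I -> cvfun d M) w :
  (\sum_(i <- r | P i) F i) w = \sum_(i <- r | P i) F i w.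
Proof.
by rewrite -[cvfun_val _]/(\val _) raddf_sum/= fct_sumE.
Qed.

End CvFun.

(** * The operator norm dominates the sup norm *)

Section Boundedness.
Variables (R : realType) (d : nat) (M : set (C R)).
Hypothesis M_compact : compact M.

(** The bound is local by continuity; a near-covering argument on [M], with the
    bounds filtered by [+oo], makes it uniform. *)
Lemma compact_cts_bounded (h : M -> C R) : continuous h ->
  exists B : R, forall w, cabs (h w) <= B.
Proof.
move=> hc.
have /filter_ex[B hB] : \forall B \near (pinfty_nbhs R), M `<=` (fun x : C R =>
    forall w : M, \val w = x -> cabs (h w) <= B).
  apply: (compact_near_coveringP M).1 => // x Mx.
  pose v : M := SigSub (mem_set Mx).
  have /(@cvgrPdist_le _ (C R)^o M _ (nbhs_filter v))/(_ 1 ltr01) := hc v.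
  rewrite /nbhs/= => -[U [[V Vo VU] vU UP]].
  exists (V, [set B | cabs (h v) + 1 <= B]); first split => /=.
  - by apply: (@open_nbhs_nbhs (C R)); split => //; rewrite -VU in vU.
  - by apply: nbhs_pinfty_ge; rewrite num_real.
  - move=> [y B] [/= Vy hB] w wy; apply: le_trans hB.
    have /UP/= : U w by rewrite -VU; move: Vy; rewrite -wy.
    rewrite cabsE lecR => hw.
    rewrite -[h w](subrK (h v)) -opprB addrC.
    apply: le_trans (cabsD _ _) _.
    by rewrite lerD2l cabsN.
by exists B => w; apply: hB (set_valP w) w erefl.
Qed.

(** Compactness matters here: [sup] of an unbounded set is [0]. *)
Lemma cabs_le_sup_norm (f : cvfun d M) w j : cabs (f w 0 j) <= sup_norm f.
Proof.
apply: le_trans (le_bigmax _ _ j).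
have [B fB] := compact_cts_bounded (@coord_continuous_cv _ _ _ f j).
apply: ub_le_sup; last by exists w.
by exists B => _ [v _ <-].
Qed.

Lemma sup_norm_le (f : cvfun d M) B : 0 <= B ->
  (forall w j, cabs (f w 0 j) <= B) -> sup_norm f <= B.
Proof.
move=> B0 fB; apply/bigmax_leP; split => // j _.
have [E0|/set0P Ene] := eqVneq [set cabs (f w 0 j) | w in [set: M]] set0.
  by rewrite E0 sup0.
by apply: ge_sup => // _ [w _ <-].
Qed.

Lemma sup_norm_ge0 (f : cvfun d M) : 0 <= sup_norm f.
Proof. exact: bigmax_ge_id. Qed.

(** By linearity, [f * g] is the combination of the [f * e_j] with the components
    of [g] as coefficients, and these are at most [1]. *)
Lemma cs_mul_bounded sigma (f g : cvfun d M) : sup_norm g <= 1 ->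
  sup_norm (cs_mul sigma f g) <=
    \sum_j sup_norm (cs_mul sigma f (const_fun M (basis_vec R j))).
Proof.
move=> g1; apply: sup_norm_le => [|w k].
  by apply: sumr_ge0 => j _; exact: sup_norm_ge0.
have -> : cs_mul sigma f g w =
    \sum_j g w 0 j *: cs_mul sigma f (const_fun M (basis_vec R j)) w.
  rewrite /= /vec_mul.
  under [RHS]eq_bigr do rewrite scaler_sumr.
  rewrite [RHS]exchange_big/=; apply: eq_bigr => i _; apply: eq_bigr => j _.
  rewrite const_funE (bigD1 j)//= big1 => [|l lj]; last first.
    by rewrite mxE (negPf lj) andbF mulr0 scale0r.
  by rewrite addr0 mxE !eqxx mulr1 scalerA mulrC.
rewrite summxE.
apply: (big_ind2 (fun (z : C R) B => cabs z <= B)).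
- by rewrite cabs0.
- move=> z1 B1 z2 B2 h1 h2.
  exact: le_trans (cabsD _ _) (lerD h1 h2).
- move=> j _; rewrite mxE cabsM -[leRHS]mul1r.
  apply: ler_pM; rewrite ?cabs_ge0//; last exact: cabs_le_sup_norm.
  exact: le_trans (cabs_le_sup_norm g w j) g1.
Qed.

(** Test the supremum on the unit, which lies in the unit ball. *)
Lemma sup_norm_le_cs_norm sigma (f : cvfun d M) : sup_norm f <= cs_norm sigma f.
Proof.
apply: ub_le_sup.
  exists (\sum_j sup_norm (cs_mul sigma f (const_fun M (basis_vec R j)))).
  by move=> _ [g /= g1 <-]; exact: cs_mul_bounded.
exists (const_fun M (const_mx 1)) => /=.
  apply: sup_norm_le => // w j.
  by rewrite const_funE mxE cabs1.
congr sup_norm; apply: cvfun_eq => w.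
by rewrite /= const_funE vec_mul_unit scale1r.
Qed.

End Boundedness.


(** * Characters and solutions of the structure equations *)

Section Characters.
Variables (R : realType) (d : nat) (M : set (C R)).
Variable sigma : 'I_d -> 'I_d -> C R.

Lemma coord_form_const_mx c (a : C R) :
  coord_form c (const_mx a : 'rV[C R]_d) = a * \sum_i c i.
Proof.
by rewrite /coord_form mulr_sumr; apply: eq_bigr => i _; rewrite mxE mulrC.
Qed.

Lemma cabs_coord_form c (x : 'rV[C R]_d) B : (forall j, cabs (x 0 j) <= B) ->
  cabs (coord_form c x) <= (\sum_i cabs (c i)) * B.
Proof.
move=> xB; rewrite mulr_suml.
apply: (big_ind2 (fun (z : C R) B => cabs z <= B)).
- by rewrite cabs0.
- by move=> z1 B1 z2 B2 h1 h2; exact: le_trans (cabsD _ _) (lerD h1 h2).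
- by move=> j _; rewrite cabsM ler_wpM2l// cabs_ge0.
Qed.

Lemma structure_point_character (w : M) c : compact M ->
  structure_point sigma (\val w) c ->
  is_character sigma (fun f : cvfun d M => coord_form c (f w)).
Proof.
move=> Mc cw; split.
- exists (const_fun M (const_mx 1)).
  by rewrite const_funE coord_form_const_mx cw.1 mulr1 oner_neq0.
- move=> f e e0; set S := \sum_i cabs (c i).
  have S0 : 0 <= S by apply: sumr_ge0 => i _; exact: cabs_ge0.
  have S1 : 0 < S + 1 by rewrite ltr_wpDl.
  exists (e / (S + 1)); first by rewrite divr_gt0.
  move=> g; rewrite ltr_pdivlMr// => gf.
  rewrite -linearB -cvfunB.
  apply: le_lt_trans gf; rewrite mulrC.
  apply: (@le_trans _ _ (S * cs_norm sigma (g - f))).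
    apply: cabs_coord_form => j.
    apply: le_trans (sup_norm_le_cs_norm Mc sigma (g - f)).
    exact: cabs_le_sup_norm.
  rewrite ler_wpM2r ?lerDl//.
  exact: le_trans (sup_norm_ge0 _) (sup_norm_le_cs_norm Mc _ _).
- by move=> f g; exact: coord_form_mul.
- by move=> a f g; rewrite cvfunD cvfunZ linearP.
Qed.

(** The constant functions [e_i] recover [c], the inclusion of [M] recovers the
    point. *)
Lemma coord_form_eval_inj (w w' : M) c c' :
  structure_point sigma (\val w) c -> structure_point sigma (\val w') c' ->
  (forall f : cvfun d M, coord_form c (f w) = coord_form c' (f w')) ->
  w = w' /\ c =1 c'.
Proof.
move=> cw cw' E; split=> [|i]; last first.
  have := E (const_fun M (basis_vec R i)).
  by rewrite !const_funE !coord_form_basis.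
have valc : continuous (fun w : M => \val w : C R).
  exact: initial_continuous.
have := E (scalar_fun d (fun w => \val w)).
rewrite !(scalar_funE _ _ valc) !coord_form_const_mx cw.1 cw'.1 !mulr1.
exact: val_inj.
Qed.

Section OneCharacter.
Variable phi : cvfun d M -> C R.
Hypothesis phi_char : is_character sigma phi.

Let phiM := character_mul phi_char.

HB.instance Definition _ :=
  GRing.isLinear.Build (C R) (cvfun d M) (C R) *%R phi
    (character_linear phi_char).

Lemma cs_mul_scalar_fun (f : cvfun d M) h w : continuous h ->
  cs_mul sigma f (scalar_fun d h) w = h w *: f w.
Proof. by move=> hc; rewrite /= scalar_funE// vec_mul_unit. Qed.

Lemma character_unit : phi (scalar_fun d (fun=> 1)) = 1.
Proof.
have [f f0] := character_nontrivial phi_char.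
apply: (mulfI f0); rewrite -phiM mulr1; congr phi; apply: cvfun_eq => w.
by rewrite cs_mul_scalar_fun ?scale1r//; exact: cst_continuous.
Qed.

(** [multiplicative_eval] with the inclusion of [M] for [u], which is
    injective. *)
Lemma character_scalar_fun : exists w0 : M, forall h : M -> C R,
  continuous h -> phi (scalar_fun d h) = h w0.
Proof.
have valc : continuous (fun w : M => \val w : C R) by exact: initial_continuous.
pose psi (h : M -> C R) := phi (scalar_fun d h).
have ev := @multiplicative_eval (C R) M (fun w => \val w) psi valc.
have psiD (h k : M -> C R) : continuous h -> continuous k ->
  psi (fun t => h t + k t) = psi h + psi k.
  move=> hc kc; rewrite /psi -raddfD; congr phi; apply: cvfun_eq => w.
  have hkc : continuous (fun t => h t + k t).
    exact: (@continuous_addf (C R) M h k hc kc).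
  apply: etrans (scalar_funE d w hkc) _.
  rewrite cvfunD (scalar_funE d w hc) (scalar_funE d w kc).
  by apply/rowP => i; rewrite !mxE.
have psiM (h k : M -> C R) : continuous h -> continuous k ->
  psi (fun t => h t * k t) = psi h * psi k.
  move=> hc kc; rewrite /psi -phiM; congr phi; apply: cvfun_eq => w.
  have hkc : continuous (fun t => h t * k t).
    exact: (@continuous_mulf (C R) M h k hc kc).
  apply: etrans (scalar_funE d w hkc) _.
  rewrite (cs_mul_scalar_fun _ w kc) (scalar_funE d w hc).
  by apply/rowP => i; rewrite !mxE mulrC.
have psiC a : psi (fun=> a) = a.
  rewrite /psi -[RHS]mulr1 -character_unit -linearZ; congr phi.
  apply: cvfun_eq => w; rewrite cvfunZ !scalar_funE; try exact: cst_continuous.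
  by apply/rowP => i; rewrite !mxE mulr1.
have {}ev := ev psiD psiM psiC.
have [w0 [w0E _]] := ev _ valc.
exists w0 => h hc; have [w [wE hE]] := ev h hc.
by rewrite -[LHS]hE; congr h; apply: val_inj; rewrite wE w0E.
Qed.

Lemma character_structure_point : exists (w : M) (c : 'I_d -> C R),
  structure_point sigma (\val w) c /\ forall f, phi f = coord_form c (f w).
Proof.
have [w0 phiE] := character_scalar_fun.
pose c i := phi (const_fun M (basis_vec R i)).
have phi_eval f : phi f = coord_form c (f w0).
  have fc i := @coord_continuous_cv _ _ _ f i.
  have {1}-> : f = \sum_i cs_mul sigma (const_fun M (basis_vec R i))
                             (scalar_fun d (fun w => f w 0 i)).
    apply: cvfun_eq => w; rewrite cvfun_sum {1}(row_sum_delta (f w)).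
    by apply: eq_bigr => i _; rewrite (cs_mul_scalar_fun _ _ (fc i)) const_funE.
  rewrite raddf_sum; apply: eq_bigr => i _.
  by rewrite /= phiM (phiE _ (fc i)).
exists w0, c; split=> //; split=> [|i j ij].
  rewrite -character_unit phi_eval scalar_funE ?coord_form_const_mx ?mul1r//.
  exact: cst_continuous.
rewrite /c -phiM phi_eval /= !const_funE vec_mul_basis /basis_mul (negPf ij).
by rewrite linearZ/= linearD !linearZ/= !coord_form_basis.
Qed.

End OneCharacter.
End Characters.

(** * The characters of the algebra of a rational function *)

Theorem theorem3p11 (R : realType) (d : nat) (p q : {poly C R})
    (lam : 'I_d -> C R) (M : set (C R))
    (hd : (0 < d)%N)
    (p_monic : p \is monic) (p_deg : size p = d.+1)
    (lam_inj : injective lam) (lam_root : forall j : 'I_d, root p (lam j))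
    (q_deg : (size q <= d)%N) (q_lam : forall j : 'I_d, q.[lam j] != 0)
    (M_nonempty : M !=set0) (M_compact : compact M) :
  (forall phi : cvfun d M -> C R,
     is_character (rat_table p q lam) phi ->
     exists z : rat_preimage p q M, phi = chi lam z)
  /\
  (exists Phi : rat_preimage p q M -> character M (rat_table p q lam),
     [/\ bijective Phi,
         forall z : rat_preimage p q M, char_fun (Phi z) = chi lam z
       & forall (f : cvfun d M) (z : rat_preimage p q M),
           gelfand f (Phi z) = chi lam z f]).
Proof.
have point (z : rat_preimage p q M) : structure_point (rat_table p q lam)
    (\val (ratfun_on z)) (fun i => delta p q lam i (\val z)).
  have [qz _] := set_valP z.
  exact: (delta_point p_monic p_deg lam_inj lam_root q_deg q_lam qz).
have chi_inj (z z' : rat_preimage p q M) : chi lam z = chi lam z' -> z = z'.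
  move=> zz'; have [qz _] := set_valP z; have [qz' _] := set_valP z'.
  have center := node_center_delta p_monic p_deg lam_inj lam_root q_deg q_lam.
  have [|wE dE] := coord_form_eval_inj (point z) (point z').
    by move=> f; exact: (congr1 (fun phi : cvfun d M -> C R => phi f) zz').
  apply: val_inj; rewrite -[LHS](center _ qz) -[RHS](center _ qz').
  have -> : ratfun p q (\val z) = ratfun p q (\val z').
    exact: (congr1 val wE).
  by congr (_ + _); apply: eq_bigr => i _; rewrite dE.
have chi_all (phi : cvfun d M -> C R) : is_character (rat_table p q lam) phi ->
    exists z : rat_preimage p q M, phi = chi lam z.
  move=> /character_structure_point[w [c [cw phiE]]].
  have [z [qz zw cE]] :=
    structure_pointE p_monic p_deg lam_inj lam_root q_deg q_lam cw.
  have zM : rat_preimage p q M z.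
    by split=> //; rewrite zw; exact: set_valP.
  pose z' : rat_preimage p q M := SigSub (mem_set zM).
  have wE : w = ratfun_on z' by exact/val_inj/esym.
  exists z'; apply/funext => f; rewrite phiE wE /chi /coord_form.
  by apply: eq_bigr => i _; rewrite cE.
split=> //.
have chi_char z : is_character (rat_table p q lam) (@chi R p q d lam M z).
  exact: (structure_point_character M_compact (point z)).
exists (fun z => Character (chi_char z)); split=> //.
exists (fun phi : character M _ => projT1 (cid (chi_all phi (charP phi))))
  => [z|phi].
  by case: cid => z' /= /chi_inj.
case: cid => z /=; case: phi => phi phi_char /= phiE.
by subst phi; congr Character; exact: Prop_irrelevance.
Qed.
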